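(* Let $I,J,K$ be spherical subsets of $S$, and let $u\in R(I,J)$, $v\in R(K,J)$ and $w\in R(I,K)$. Fix a reduced expression $\boldsymbol{v}$ for $v$ and, for each $m\in M_K(J,v)$, a reduced expression $\boldsymbol{m}$ for $m$. Then $$c_{u,v}^w(I,J,K)=\sum_{\gamma}q(\gamma),$$ where the sum is over all pointed pregalleries $\gamma$ of type $\boldsymbol{m}\boldsymbol{v}$ (the concatenation of $\boldsymbol{m}$ and $\boldsymbol{v}$), for some $m\in M_K(J,v)$, starting at $w$ and with $\mathrm{end}(\gamma)\in W_IuW_J$.
   Context: $(W,S)$ is a Coxeter system with $S$ finite and length $\ell$. For $I\subseteq S$, $W_I=\langle I\rangle$; $I$ is spherical if $W_I$ is finite. $R(I,J)$ is the set of minimal-length representatives of double cosets $W_IwW_J$. For $v\in R(K,J)$, $M_K(J,v)$ is the set of minimal-length representatives of the left cosets in $W_K/(W_K\cap vW_Jv^{-1})$. $X$ is a locally finite building of type $(W,S)$, chamber set $\mathcal{C}$, Weyl distance $\delta$, regular with parameters $q_s$ (each cotype-$\{s\}$ panel lies in $q_s+1$ chambers). Simplices have cotypes (complement of type); $X_I$ = cotype-$I$ simplices; $\mathcal{C}(A)$ = chambers containing $A$; for $A\in X_I$, $B\in X_J$, $\delta(A,B)$ is the element of $R(I,J)$ in the double coset $\delta(\mathcal{C}(A)\times\mathcal{C}(B))$; $F(A,J,u)=\{D\in X_J:\delta(A,D)=u\}$. The number $|F(A,J,u)\cap F(B,J,v)|$ is the same for all $A\in X_I$, $B\in X_K$ with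 $\delta(A,B)=w$, and is denoted $c_{u,v}^w(I,J,K)$. A pointed pregallery of type $(s_1,\ldots,s_n)$ is a sequence $\gamma=(w_0,s_1,w_1,\ldots,s_n,w_n)$, $w_j\in W$, with $w_j\in\{w_{j-1},w_{j-1}s_j\}$, and $\ell(w_{j-1}s_j)<\ell(w_{j-1})$ whenever $w_{j-1}=w_j$; it starts at $w_0$, $\mathrm{end}(\gamma)=w_n$. Set $\alpha_s(\gamma)=|\{j:s_j=s,\ \ell(w_{j-1})<\ell(w_j)\}|$, $\sigma_s(\gamma)=|\{j:s_j=s,\ w_j=w_{j-1}\}|$, $q(\gamma)=\prod_{s}q_s^{\alpha_s(\gamma)}(q_s-1)^{\sigma_s(\gamma)}$. *)

(* Defs.v *)
From HB Require Import structures.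
From mathcomp Require Import all_boot finmap.
From mathcomp Require Import boolp classical_sets functions cardinality fsbigop.

Set Implicit Arguments.
Unset Strict Implicit.
Unset Printing Implicit Defensive.

Local Open Scope classical_set_scope.
Local Open Scope card_scope.
Local Open Scope group_scope.

Section CoxeterGroup.
Variables (W : groupType) (S : finType) (gen : S -> W).
Implicit Types (I J K : {set S}) (u v w : W) (x : seq S).

(* The finite set S of generators is embedded in W by gen.  The last field is
   the universal property of the presentation
   < S | (st)^m(s,t) = 1 for m(s,t) finite >, where m(s,t) is the order of st
   in W: the hypothesis on f says that f satisfies every relation of the form
   (st)^n = 1 that holds in W. *)
Record coxeter_system : Prop := CoxeterSystem {
  cox_inj : injective gen;
  cox_neq1 : forall s, gen s <> 1;
  cox_invol : forall s, gen s * gen s = 1;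
  cox_generate : forall w, exists x, \prod_(s <- x) gen s = w;
  cox_present : forall (G : groupType) (f : S -> G),
    (forall s t n, (gen s * gen t) ^+ n = 1 -> (f s * f t) ^+ n = 1) ->
    exists phi : {multiplicative W -> G}, forall s, phi (gen s) = f s
}.

Definition word_val x : W := \prod_(s <- x) gen s.

Definition is_length w (n : nat) : Prop :=
  (exists2 x, size x = n & word_val x = w) /\
  (forall x, word_val x = w -> n <= size x).

(* The default value 0 is never used when gen generates W. *)
Definition cox_length w : nat := xget 0 [set n | is_length w n].

Definition reduced_expr x w : Prop :=
  word_val x = w /\ size x = cox_length w.

(* The subgroup generated by I: inverses are not needed since the generators
   are involutions. *)
Definition parabolic I : set W :=
  [set w | exists2 x, {subset x <= I} & word_val x = w].

Definition spherical I : Prop := finite_set (parabolic I).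

Definition double_coset I w J : set W :=
  [set y | exists a b, [/\ parabolic I a, parabolic J b & y = a * w * b]].

(* R(I,J) *)
Definition double_coset_reps I J : set W :=
  [set w | forall y, double_coset I w J y -> cox_length w <= cox_length y].

(* M_K(J,v) *)
Definition left_coset_reps K J v : set W :=
  [set m | parabolic K m /\
     forall y, parabolic K y -> parabolic J (v^-1 * y * v) ->
       cox_length m <= cox_length (m * y)].

Definition std_coset w I : set W := [set w * y | y in parabolic I].

(* The simplices of the Coxeter complex are the standard cosets; A is a face
   of B when B is contained in A. *)
Definition coxeter_complex : set (set W) :=
  [set F | exists w I, F = std_coset w I].

(* The pregallery (w_0, s_1, w_1, .., s_n, w_n) is encoded as
   (w_0, [:: (s_1, w_1); ..; (s_n, w_n)]). *)
Definition pregallery : Type := (W * seq (S * W))%type.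

Definition pg_start (g : pregallery) : W := g.1.
Definition pg_end (g : pregallery) : W := last g.1 (map snd g.2).
Definition pg_type (g : pregallery) : seq S := map fst g.2.

(* The list of the triples (w_(j-1), s_j, w_j). *)
Fixpoint steps_from w (p : seq (S * W)) : seq (W * S * W) :=
  if p is (s, w') :: p' then (w, s, w') :: steps_from w' p' else [::].

Definition pg_steps (g : pregallery) := steps_from g.1 g.2.

Definition is_pointed_step (e : W * S * W) : bool :=
  let: (a, s, b) := e in
  ((b == a) || (b == a * gen s)) &&
  ((a == b) ==> (cox_length (a * gen s) < cox_length a)).

Definition is_pointed_pregallery (g : pregallery) : bool :=
  all is_pointed_step (pg_steps g).

Definition pg_alpha (s : S) (g : pregallery) : nat :=
  count (fun e : W * S * W => let: (a, t, b) := e in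
           (t == s) && (cox_length a < cox_length b)) (pg_steps g).

Definition pg_sigma (s : S) (g : pregallery) : nat :=
  count (fun e : W * S * W => let: (a, t, b) := e in
           (t == s) && (b == a)) (pg_steps g).

(* For the parameters of a regular building q s >= 1, as every panel lies in at
   least two chambers, so the subtraction is not truncated. *)
Definition pg_weight (q : S -> nat) (g : pregallery) : nat :=
  (\prod_(s : S) (q s ^ pg_alpha s g * (q s - 1) ^ pg_sigma s g))%N.

End CoxeterGroup.

Section Building.
Variables (W : groupType) (S : finType) (gen : S -> W).

(* A simplicial complex, given by its finite vertex sets (including the empty
   simplex), with a type function on its vertices. *)
Record typed_complex := TypedComplex {
  vertex : choiceType;
  simplex : set {fset vertex};
  vtype : vertex -> S;
  simplex0 : simplex fset0;
  simplex1 : forall a, simplex [fset a]%fset;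
  simplex_face : forall A B, simplex B -> (A `<=` B)%fset -> simplex A;
  vtype_inj : forall A, simplex A -> {in A &, injective vtype}
}.

Definition cotype (X : typed_complex) (A : {fset vertex X}) : {set S} :=
  ~: [set s | s \in [seq vtype a | a <- enum_fset A]]%SET.

Definition subcomplex (X : typed_complex) (Sg : set {fset vertex X}) : Prop :=
  [/\ Sg `<=` @simplex X, Sg fset0 &
      forall A B, Sg B -> (A `<=` B)%fset -> Sg A].

Definition complex_iso (X : typed_complex) (Sg Sg' : set {fset vertex X})
    (f : {fset vertex X} -> {fset vertex X}) : Prop :=
  set_bij Sg Sg' f /\
  forall A B, Sg A -> Sg B -> (A `<=` B)%fset = (f A `<=` f B)%fset.

(* A type-preserving isomorphism onto the Coxeter complex of (W,S); the coset
   w W_I has cotype I. *)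
Definition coxeter_iso (X : typed_complex) (Sg : set {fset vertex X})
    (phi : {fset vertex X} -> set W) : Prop :=
  [/\ set_bij Sg (coxeter_complex gen) phi,
      forall A B, Sg A -> Sg B -> ((A `<=` B)%fset <-> phi B `<=` phi A) &
      forall A, Sg A -> exists w, phi A = std_coset gen w (cotype A)].

(* A simplicial building of type (W,S) with a system of apartments.  Fixing A
   and B pointwise means fixing all their vertices, i.e. all their faces. *)
Record building := Building {
  bcomplex :> typed_complex;
  apartment : set (set {fset vertex bcomplex});
  apartment_sub : forall Sg, apartment Sg -> subcomplex Sg;
  apartment_coxeter : forall Sg, apartment Sg ->
    exists phi, coxeter_iso Sg phi;
  apartment_common : forall A B : {fset vertex bcomplex},
    simplex A -> simplex B -> exists Sg, [/\ apartment Sg, Sg A & Sg B];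
  apartment_iso : forall Sg Sg' A B, apartment Sg -> apartment Sg' ->
    Sg A -> Sg B -> Sg' A -> Sg' B ->
    exists f, complex_iso Sg Sg' f /\
      forall D, (D `<=` A)%fset || (D `<=` B)%fset -> f D = D
}.

Variable X : building.
Implicit Types A B C D : {fset vertex X}.
Implicit Types (I J K : {set S}) (u v w : W).

Definition chamber : set {fset vertex X} :=
  [set C | simplex C /\ forall A, simplex A -> (C `<=` A)%fset -> A = C].

Definition chambers_of A : set {fset vertex X} :=
  [set C | chamber C /\ (A `<=` C)%fset].

(* X_I *)
Definition cotype_simplices I : set {fset vertex X} :=
  [set A | simplex A /\ cotype A = I].

(* If an isomorphism from an apartment containing C and D to the Coxeter
   complex maps C to {a} and D to {aw}, then the Weyl distance is w, whatever
   the apartment and the isomorphism. *)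
Definition is_weyl_dist C D w : Prop :=
  exists Sg phi a, [/\ apartment Sg, coxeter_iso Sg phi, Sg C /\ Sg D,
    phi C = [set a] & phi D = [set a * w]].

Definition weyl_dist C D : W := xget 1 [set w | is_weyl_dist C D w].

(* The default value 1 is never used: the set is a singleton. *)
Definition simplex_dist A B : W :=
  xget 1 [set w | double_coset_reps gen (cotype A) (cotype B) w /\
    exists C D, [/\ chambers_of A C, chambers_of B D & weyl_dist C D = w]].

(* F(A,J,u) *)
Definition sphere A J u : set {fset vertex X} :=
  [set D | cotype_simplices J D /\ simplex_dist A D = u].

Definition locally_finite : Prop :=
  forall A s, cotype_simplices [set s]%SET A -> finite_set (chambers_of A).

Definition regular (q : S -> nat) : Prop :=
  forall A s, cotype_simplices [set s]%SET A -> chambers_of A #= `I_(q s).+1.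

(* n is the number c_(u,v)^w(I,J,K) *)
Definition is_intersection_number I J K u v w (n : nat) : Prop :=
  forall A B, cotype_simplices I A -> cotype_simplices K B ->
    simplex_dist A B = w -> sphere A J u `&` sphere B J v #= `I_n.

End Building.

(* Main.v *)
(* Fix chambers C0 in C(A) and C1 in C(B) with delta(C0,C1) = w.  Sending a
   chamber E to its face of cotype J is a bijection from the chambers E with
   delta(C1,E) = mv, m in M_K(J,v), onto F(B,J,v): for m in M_K(J,v) the elements
   mv are the minimal representatives of the left cosets of W_J in W_K v W_J, and
   len(mv) = len(m) + len(v), so E is the chamber of its residue closest to C1.
   Under this bijection F(A,J,u) corresponds to delta(C0,E) in W_I u W_J.  The
   chambers E with delta(C1,E) = mv are the ends of the galleries of type mv from
   C1, each arising once, and delta(C0,-) maps such a gallery to a pointed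
   pregallery starting at w.  At each step the panel of type s containing the
   current chamber D, at distance a from C0, has q_s further chambers, all at
   distance as if len(as) > len(a); otherwise one of them is at distance as and
   the other q_s - 1 are at distance a. *)
Require Import Defs.
From HB Require Import structures.
From mathcomp Require Import all_boot finmap.
From mathcomp Require Import boolp classical_sets functions cardinality fsbigop.

Set Implicit Arguments.
Unset Strict Implicit.
Unset Printing Implicit Defensive.

Local Open Scope classical_set_scope.

(** * Coxeter groups *)

(* W acts by conjugation on the group of subsets of W under symmetric
   difference; subsets are given by their indicator functions. *)
Definition subset_semidirect (W : groupType) : Type := ((W -> bool) * W)%type.

Section SubsetSemidirect.
Local Open Scope group_scope.
Variable W : groupType.
Local Notation G := (subset_semidirect W).

HB.instance Definition _ := gen_eqMixin G.
HB.instance Definition _ := gen_choiceMixin G.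

Definition sd_one : G := (fun=> false, 1).
Definition sd_inv (g : G) : G := (fun r => g.1 (r ^ g.2^-1), g.2^-1).
Definition sd_mul (g h : G) : G := (fun r => g.1 r (+) h.1 (r ^ g.2), g.2 * h.2).

Lemma sd_mulA : associative sd_mul.
Proof.
move=> [f a] [g b] [h c]; rewrite /sd_mul /= mulgA; congr pair.
by apply/funext => r; rewrite addbA conjgM.
Qed.

Lemma sd_mul1 : left_id sd_one sd_mul.
Proof.
move=> [f a]; rewrite /sd_mul /= mul1g; congr pair.
by apply/funext => r; rewrite conjg1.
Qed.

Lemma sd_mulr1 : right_id sd_one sd_mul.
Proof.
move=> [f a]; rewrite /sd_mul /= mulg1; congr pair.
by apply/funext => r; rewrite addbF.
Qed.

Lemma sd_mulV : left_inverse sd_one sd_inv sd_mul.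
Proof.
move=> [f a]; rewrite /sd_mul /= mulVg; congr pair.
by apply/funext => r; rewrite addbb.
Qed.

Lemma sd_mulVr : right_inverse sd_one sd_inv sd_mul.
Proof.
move=> [f a]; rewrite /sd_mul /= mulgV; congr pair.
by apply/funext => r; rewrite conjgK addbb.
Qed.

HB.instance Definition _ :=
  isGroup.Build G sd_mulA sd_mul1 sd_mulr1 sd_mulV sd_mulVr.

Lemma sd_expg (g : G) n :
  (g ^+ n).2 = g.2 ^+ n /\
  forall r, (g ^+ n).1 r = \big[addb/false]_(0 <= i < n) g.1 (r ^ (g.2 ^+ i)).
Proof.
elim: n => [|n [IH2 IH1]].
  by rewrite !expg0; split=> // r; rewrite big_geq.
rewrite !expgSr; split; first by rewrite -IH2.
by move=> r; rewrite big_nat_recr //= -IH1 -IH2.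
Qed.

End SubsetSemidirect.

Section Coxeter.
Local Open Scope group_scope.
Variables (W : groupType) (S : finType) (gen : S -> W).
Hypothesis hW : coxeter_system gen.
Implicit Types (I J K : {set S}) (u v w : W) (x y : seq S).
Local Notation val := (word_val gen).
Local Notation len := (cox_length gen).

Lemma genV s : (gen s)^-1 = gen s.
Proof. by apply: mulg1_eq; apply: cox_invol hW _. Qed.

Lemma genK s w : w * gen s * gen s = w.
Proof. by rewrite -mulgA (cox_invol hW) mulg1. Qed.

Lemma val_nil : val [::] = 1. Proof. by rewrite /word_val big_nil. Qed.

Lemma val_cons s x : val (s :: x) = gen s * val x.
Proof. by rewrite /word_val big_cons. Qed.

Lemma val_cat x y : val (x ++ y) = val x * val y.
Proof. by rewrite /word_val big_cat. Qed.

Lemma val_seq1 s : val [:: s] = gen s.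
Proof. by rewrite val_cons val_nil mulg1. Qed.

Lemma val_rev x : val (rev x) = (val x)^-1.
Proof.
elim: x => [|s x IH]; first by rewrite val_nil invg1.
by rewrite rev_cons -cats1 val_cat IH val_seq1 val_cons invgM genV.
Qed.

(* [parity x r] is the parity of the number of the prefixes [z ++ [:: s]] of
   [x] with [r = val z * gen s * (val z)^-1]. *)
Fixpoint parity x (r : W) : bool :=
  if x is s :: x' then (r == gen s) (+) parity x' (r ^ gen s) else false.

Lemma parity_cat x y r : parity (x ++ y) r = parity x r (+) parity y (r ^ val x).
Proof.
elim: x r => [|s x IH] r /=; first by rewrite val_nil conjg1.
by rewrite IH addbA val_cons conjgM.
Qed.

(** By [sd_gen_rel] and [cox_present] these elements extend to a homomorphism from W, whose first
    component at [val x] is [parity x]. *)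
Definition sd_gen s : subset_semidirect W := (fun r => r == gen s, gen s).

(* For p = st, the reflections along the word (st)^n are the p^j s, j < 2n. *)
Lemma sd_gen_rel s t n :
  (gen s * gen t) ^+ n = 1 -> (sd_gen s * sd_gen t) ^+ n = 1.
Proof.
set p := gen s * gen t => pn1.
have [E2 E1] := sd_expg (sd_gen s * sd_gen t) n.
rewrite [LHS]surjective_pairing E2.
have -> : (sd_gen s * sd_gen t).2 ^+ n = 1 by [].
suff -> : ((sd_gen s * sd_gen t) ^+ n).1 = fun=> false by [].
apply/funext => r; rewrite E1 /=.
(* Conjugation by s inverts p = st. *)
have sp i : p ^+ i * gen s = gen s * p ^- i.
  elim: i => [|i IH]; first by rewrite expg0 invg1 mul1g mulg1.
  rewrite expgSr -mulgA.
  have -> : p * gen s = gen s * p^-1.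
    by rewrite /p invgM !genV mulgA.
  by rewrite mulgA IH -mulgA -invgM -expgS -expgSr.
(* The i-th factor st contributes the two reflections p^(2i) s and p^(2i+1) s. *)
have F i : ((r ^ (p ^+ i) == gen s) (+) ((r ^ (p ^+ i)) ^ gen s == gen t)) =
    (r == p ^+ (i.*2) * gen s) (+) (r == p ^+ (i.*2).+1 * gen s).
  have A (a b c : W) : (a ^ b == c) = (a == b * c * b^-1).
    apply/eqP/eqP => [<-|->]; first by rewrite conjgE !mulgA mulgV mul1g mulgK.
    by rewrite conjgE !mulgA mulVg mul1g mulgVK.
  congr (_ (+) _).
    by rewrite A -[_ * _ * _]mulgA -sp mulgA -expgnDr addnn.
  rewrite -conjgM A invgM genV.
  have -> : p ^+ i * gen s * gen t * (gen s * p ^- i) =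
      p ^+ i * p * (p ^+ i * gen s) by rewrite [in RHS]sp /p !mulgA.
  by rewrite -expgSr mulgA -expgnDr addSn addnn.
transitivity (\big[addb/false]_(0 <= j < n.*2) (r == p ^+ j * gen s)).
  elim: (n) => [|m IH]; first by rewrite double0 !big_geq.
  rewrite big_nat_recr //= IH doubleS !big_nat_recr //=.
  by rewrite -addbA -F.
(* As p^n = 1, the second half of the list of reflections repeats the first, so every count is
   even. *)
rewrite -addnn (@big_cat_nat _ _ _ n) //= ?leq_addr //.
have -> : \big[addb/false]_(n <= j < n + n) (r == p ^+ j * gen s) =
    \big[addb/false]_(0 <= j < n) (r == p ^+ j * gen s).
  rewrite -{1}[n]add0n big_addn addnK; apply: eq_bigr => j _.
  by rewrite expgnDr pn1 mulg1.
by rewrite addbb.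
Qed.

(** [parity x] is a component of the image of [val x] under a homomorphism, so it depends on [val x]
    only. *)
Lemma parity_eq x y : val x = val y -> parity x =1 parity y.
Proof.
have [phi Hphi] := cox_present hW sd_gen_rel.
have phi1 : phi 1 = 1 by apply: (@mulgI _ (phi 1)); rewrite -gmulfM !mulg1.
suff E z : (phi (val z)).1 =1 parity z by move=> Exy r; rewrite -!E Exy.
have P2 w : (phi w).2 = w.
  have [x0 <-] := cox_generate hW w; rewrite -/(val x0).
  elim: x0 => [|s x0 IH]; first by rewrite val_nil phi1.
  by rewrite val_cons gmulfM Hphi /= IH.
elim: z => [|s z IH] r; first by rewrite val_nil phi1.
by rewrite val_cons gmulfM Hphi /= IH.
Qed.

(** A reflection of odd parity is the conjugate of a letter of x by the prefix before it, and
    multiplying by it on the left cancels that letter. *)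
Lemma parity_delete x r : parity x r ->
  exists x1 s x2, x = x1 ++ s :: x2 /\ r * val x = val (x1 ++ x2).
Proof.
elim: x r => [//|s x IH] r /=; case: eqVneq => [-> _|_ /= /IH].
  exists [::], s, x; split=> //.
  by rewrite val_cons mulgA (cox_invol hW) mul1g.
move=> [x1 [t [x2 [-> E]]]]; exists (s :: x1), t, x2; split=> //=.
rewrite !val_cons -E conjgE genV !mulgA (cox_invol hW) mul1g.
by [].
Qed.

(** * Length, exchange and deletion *)

Lemma is_length_exists w : exists n, is_length gen w n.
Proof.
have [x0 Hx0] := cox_generate hW w.
have ex : exists n, `[< exists2 x, size x = n & val x = w >].
  by exists (size x0); apply/asboolP; exists x0.
case: (ex_minnP ex) => n /asboolP Hn Hmin; exists n; split=> // x Hx.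
by apply: Hmin; apply/asboolP; exists x.
Qed.

Lemma reduced_word w : exists2 x, val x = w & size x = len w.
Proof.
by have [[x]] := xgetPex 0%N (is_length_exists w); exists x.
Qed.

Lemma len_le x : (len (val x) <= size x)%N.
Proof. by have [_] := xgetPex 0%N (is_length_exists (val x)); apply. Qed.

Lemma lenM u v : (len (u * v) <= len u + len v)%N.
Proof.
have [x <- <-] := reduced_word u; have [y <- <-] := reduced_word v.
by rewrite -val_cat -size_cat len_le.
Qed.

Lemma len1 : len 1 = 0%N.
Proof. by apply/eqP; rewrite -leqn0 -val_nil; apply: len_le. Qed.

Lemma len_eq0 w : len w = 0%N -> w = 1.
Proof. by have [[|s x] <- <- //] := reduced_word w; rewrite val_nil. Qed.

Lemma len_gen s : len (gen s) = 1%N.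
Proof.
apply/eqP; rewrite eqn_leq lt0n -{1}val_seq1 len_le /=; apply/eqP => /len_eq0.
exact: cox_neq1 hW s.
Qed.

(** Let t = w s w^-1. If t is odd in x, a letter of x can be deleted. Otherwise t is odd in x
    followed by s, hence in a reduced word of ws, and deleting there gives a word for w shorter than
    ws. *)
Lemma exchange x s :
  (exists x1 t x2, x = x1 ++ t :: x2 /\ val x * gen s = val (x1 ++ x2)) \/
  (len (val x) < len (val x * gen s))%N.
Proof.
set w := val x; pose t := gen s ^ w^-1.
have tE : t * w = w * gen s by rewrite /t conjgE invgK -!mulgA mulVg mulg1.
case Pt : (parity x t).
  left; have [x1 [s' [x2 [Ex E]]]] := parity_delete Pt.
  by exists x1, s', x2; split=> //; rewrite -E -tE.
right; have [y Ey <-] := reduced_word (w * gen s).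
have : parity y t.
  rewrite (@parity_eq y (x ++ [:: s])) ?Ey ?val_cat ?val_seq1 //.
  by rewrite parity_cat Pt /= /t -/w conjgKV eqxx.
move=> /parity_delete[x1 [s' [x2 [Ely E]]]].
have -> : w = val (x1 ++ x2) by rewrite -E Ey mulgA tE genK.
by rewrite (leq_ltn_trans (len_le _)) // Ely !size_cat /= addnS.
Qed.

(** On a reduced word of w, a deletion writes ws with one letter less; hence multiplying by s always
    changes the length. *)
Lemma len_genC w s : ~~ (len w < len (w * gen s))%N -> (len (w * gen s) < len w)%N.
Proof.
move=> N; have [x Ex Lx] := reduced_word w; move: N; rewrite -Ex => N.
case: (exchange x s) => [[x1 [t [x2 [E ->]]]]|H]; last by rewrite H in N.
by rewrite (leq_ltn_trans (len_le _)) // Ex -Lx E !size_cat /= addnS.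
Qed.

(** The word is reduced from left to right: the last letter either lengthens the reduced prefix or
    deletes one of its letters. *)
Lemma deletion x : exists y, [/\ subseq y x, val y = val x & size y = len (val x)].
Proof.
elim/last_ind: x => [|p s [y [sub Ey Sy]]].
  by exists [::]; rewrite val_nil len1.
rewrite -cats1 val_cat val_seq1.
case: (exchange y s) => [[x1 [t [x2 [E Es]]]]|H].
  exists (x1 ++ x2); split.
  - apply: subseq_trans (prefix_subseq _ _).
    by apply: subseq_trans sub; rewrite E cat_subseq // subseq_cons.
  - by rewrite -Es Ey.
  (* Appending s lowers the length by at most one, so y without the deleted letter is still
     reduced. *)
  - have H1 := lenM (val p * gen s) (gen s).
    rewrite genK -Sy E -Ey Es in H1 *.
    have H2 : (len (gen s) <= 1)%N by rewrite -val_seq1; apply: len_le.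
    apply/eqP; rewrite eqn_leq len_le andbT.
    move: (leq_trans H1 (leq_add (leqnn _) H2)).
    by rewrite !size_cat /= !addnS addn0 ltnS.
exists (y ++ [:: s]); split; first by rewrite cat_subseq.
  by rewrite val_cat val_seq1 Ey.
rewrite Ey -Sy in H; apply/eqP; rewrite size_cat addn1 eqn_leq H /=.
rewrite (leq_trans (lenM _ _)) // -Sy -addn1 leq_add2l -val_seq1.
exact: len_le.
Qed.

Lemma reduced_cons s x :
  len (val (s :: x)) = (size x).+1 -> len (val x) = size x.
Proof.
move=> E; apply/eqP; rewrite eqn_leq len_le /= -ltnS -E val_cons.
rewrite (leq_trans (lenM _ _)) // -val_seq1.
by rewrite -add1n leq_add2r len_le.
Qed.

(** * Standard parabolic subgroups *)

Lemma parabolic_val I x : {subset x <= I} -> parabolic gen I (val x).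
Proof. by move=> H; exists x. Qed.

Lemma parabolic1 I : parabolic gen I 1.
Proof. by exists [::]; rewrite ?val_nil. Qed.

Lemma parabolicM I u v :
  parabolic gen I u -> parabolic gen I v -> parabolic gen I (u * v).
Proof.
move=> [x xI <-] [y yI <-]; rewrite -val_cat; apply: parabolic_val => s.
by rewrite mem_cat => /orP[/xI|/yI].
Qed.

Lemma parabolicV I u : parabolic gen I u -> parabolic gen I u^-1.
Proof.
move=> [x xI <-]; rewrite -val_rev; apply: parabolic_val => s.
by rewrite mem_rev; apply: xI.
Qed.

(** Deletion only removes letters, so the reduced word still has its letters in I. *)
Lemma parabolic_reduced I u : parabolic gen I u ->
  exists x, [/\ {subset x <= I}, val x = u & size x = len u].
Proof.
move=> [x xI <-]; have [y [sub Ey Sy]] := deletion x.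
by exists y; split=> // s /(mem_subseq sub)/xI.
Qed.

Lemma parabolic0 u : parabolic gen finset.set0 u -> u = 1.
Proof.
by move=> [[|s x] H <-]; rewrite ?val_nil //; have := H s (mem_head _ _); rewrite inE.
Qed.

(** A reduced word of [gen s] with letters in I is a single letter, and it is s because [gen] is
    injective. *)
Lemma parabolic_gen I s : parabolic gen I (gen s) <-> s \in I.
Proof.
split=> [/parabolic_reduced[x [xI Ex Sx]]|sI]; last first.
  by rewrite -val_seq1; apply: parabolic_val => t; rewrite inE => /eqP->.
have : (size x <= 1)%N by rewrite Sx -val_seq1 len_le.
case: x xI Ex {Sx} => [|t [|//]] xI Ex _.
  by case: (@cox_neq1 _ _ _ hW s); rewrite -Ex val_nil.
rewrite val_seq1 in Ex; rewrite -(cox_inj hW Ex).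
by apply: xI; rewrite mem_head.
Qed.

Lemma parabolic_set1 s u : parabolic gen [set s]%SET u -> u = 1 \/ u = gen s.
Proof.
move=> [x xs <-]; elim: x xs => [|t x IH] xs; first by left; rewrite val_nil.
have -> : t = s by have := xs t (mem_head _ _); rewrite inE => /eqP.
case: IH => [z zx|E|E]; first by apply: xs; rewrite inE zx orbT.
  by right; rewrite val_cons E mulg1.
by left; rewrite val_cons E (cox_invol hW).
Qed.

(** * Double cosets and their shortest elements *)

Lemma double_cosetxx I J w : double_coset gen I w J w.
Proof.
by exists 1, 1; split; rewrite ?mulg1 ?mul1g //; apply: parabolic1.
Qed.

Lemma double_coset_sym I J w (y : W) :
  double_coset gen I w J y -> double_coset gen I y J w.
Proof.
move=> [a [b [Ha Hb ->]]]; exists a^-1, b^-1; split; try exact: parabolicV.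
by rewrite !mulgA mulVg mul1g mulgK.
Qed.

Lemma double_coset_trans I J w (y z : W) : double_coset gen I w J y ->
  double_coset gen I y J z -> double_coset gen I w J z.
Proof.
move=> [a [b [Ha Hb ->]]] [c [d [Hc Hd ->]]]; exists (c * a), (b * d).
by split; rewrite ?mulgA //; apply: parabolicM.
Qed.

Lemma double_coset_mull I J a w :
  parabolic gen I a -> double_coset gen I w J (a * w).
Proof. by move=> Ha; exists a, 1; rewrite mulg1; split=> //; apply: parabolic1. Qed.

Lemma double_coset_mulr I J b w :
  parabolic gen J b -> double_coset gen I w J (w * b).
Proof. by move=> Hb; exists 1, b; rewrite mul1g; split=> //; apply: parabolic1. Qed.

Lemma double_coset_reps_exists I J w :
  exists2 y, double_coset_reps gen I J y & double_coset gen I w J y.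
Proof.
have ex : exists n, `[< exists2 y, double_coset gen I w J y & len y = n >].
  by exists (len w); apply/asboolP; exists w => //; apply: double_cosetxx.
case: (ex_minnP ex) => n /asboolP[y Dy <-] Hmin; exists y => // z Dz.
by apply: Hmin; apply/asboolP; exists z => //; apply: double_coset_trans Dz.
Qed.

Lemma subseq_catP (x y z : seq S) : subseq z (x ++ y) ->
  exists z1 z2, [/\ z = z1 ++ z2, subseq z1 x & subseq z2 y].
Proof.
move=> /subseqP[m Sm ->]; exists (mask (take (size x) m) x), (mask (drop (size x) m) y).
split; try exact: mask_subseq.
rewrite -mask_cat ?cat_take_drop // size_takel //.
by rewrite Sm size_cat leq_addr.
Qed.

(* Reduce the word of a v b: a letter deleted from the word of v would give an
   element of W_K v W_J shorter than v. *)
Lemma double_coset_additive K J v a b : double_coset_reps gen K J v ->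
  parabolic gen K a -> parabolic gen J b ->
  exists a' b', [/\ parabolic gen K a', parabolic gen J b',
    a * v * b = a' * v * b' & len (a * v * b) = (len a' + len v + len b')%N].
Proof.
move=> Hv Ha Hb; have [xa Ka Ea] := Ha; have [xb Jb Eb] := Hb.
have [xv Ev Sv] := reduced_word v.
have [y [sub Ey Sy]] := deletion ((xa ++ xv) ++ xb).
have [y' [yb [Eyb /subseq_catP[ya [yv [Eya suba subv]]] subb]]] := subseq_catP sub.
have Ka' : parabolic gen K (val ya).
  by apply: parabolic_val => s /(mem_subseq suba)/Ka.
have Jb' : parabolic gen J (val yb).
  by apply: parabolic_val => s /(mem_subseq subb)/Jb.
have E : val ya * val yv * val yb = a * v * b.
  by rewrite -!val_cat -Eya -Eyb Ey !val_cat Ev -/(val xa) Ea -/(val xb) Eb.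
have Eyv : yv = xv.
  apply/eqP; rewrite -(size_subseq_leqif subv) eqn_leq (size_subseq subv) /= Sv.
  apply: leq_trans (len_le _); apply: Hv.
  exists ((val ya)^-1 * a), (b * (val yb)^-1).
  split; try by apply: parabolicM => //; apply: parabolicV.
  by rewrite !mulgA -(mulgA _ a v) -(mulgA _ (a * v)) -E !mulgA mulVg mul1g mulgK.
exists (val ya), (val yb); split=> //; first by rewrite -E Eyv Ev.
apply/eqP; rewrite eqn_leq; apply/andP; split.
  rewrite -E Eyv Ev (leq_trans (lenM _ _)) // leq_add2r; exact: lenM.
rewrite -E -!val_cat -Eya -Eyb Ey -Sy Eyb Eya !size_cat Eyv Sv.
by rewrite !leq_add ?len_le.
Qed.

(** Write w = a' v b' with additive lengths; since w is no longer than v, both a' and b' are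
    trivial. *)
Lemma double_coset_reps_uniq I J v w : double_coset_reps gen I J v ->
  double_coset_reps gen I J w -> double_coset gen I v J w -> v = w.
Proof.
move=> Hv Hw D; have [a [b [Ha Hb E]]] := D.
have [a' [b' [Ha' Hb' E' L]]] := double_coset_additive Hv Ha Hb.
have := Hw _ (double_coset_sym D).
rewrite E L addnAC -[X in (_ <= X)%N]add0n leq_add2r leqn0 addn_eq0.
by move=> /andP[/eqP/len_eq0 A /eqP/len_eq0 B]; rewrite E' A B mul1g mulg1.
Qed.

(** With [finset.set0] on the left, a double coset is a left coset, so the hypothesis says that y is
    shortest in y W_J. *)
Lemma min_coset_len J (y b : W) : double_coset_reps gen finset.set0 J y ->
  parabolic gen J b -> len (y * b) = (len y + len b)%N.
Proof.
move=> Hy Hb.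
have [a' [b' [/parabolic0-> Hb' E]]] :=
  double_coset_additive Hy (parabolic1 _) Hb.
rewrite !mul1g in E *; move/mulgI: E => <- ->.
by rewrite len1.
Qed.

(** * The representatives M_K(J,v) *)

Section LeftCosetReps.
Variables (K J : {set S}) (v : W).
Hypothesis hv : double_coset_reps gen K J v.

(** Take y shortest in z W_J and write y = a v b' with additive lengths. As a v lies in the same
    coset, b' is trivial. *)
Lemma coset_factor z : double_coset gen K v J z ->
  exists a, [/\ parabolic gen K a, double_coset_reps gen finset.set0 J (a * v),
    parabolic gen J (z^-1 * (a * v)) & len (a * v) = (len a + len v)%N].
Proof.
move=> Dz.
have [y Ry [c [b [/parabolic0-> Hb]]]] := double_coset_reps_exists finset.set0 J z.
rewrite mul1g => Ey.
have [a0 [b0 [Ha0 Hb0 Ey0]]] : double_coset gen K v J y.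
  by rewrite Ey; apply: double_coset_trans Dz _; apply: double_coset_mulr.
have [a [b' [Ha Hb' E L]]] := double_coset_additive hv Ha0 Hb0.
have Lb : len b' = 0%N.
  have : (len y <= len (a * v))%N.
    apply: Ry; exists 1, b'^-1; rewrite mul1g.
    split; [exact: parabolic1|exact: parabolicV|].
    by rewrite Ey0 E mulgK.
  rewrite Ey0 L => H; have := leq_trans H (lenM a v).
  by rewrite -[X in (_ <= X)%N]addn0 leq_add2l leqn0 => /eqP.
have Ey' : y = a * v by rewrite Ey0 E (len_eq0 Lb) mulg1.
exists a; rewrite -Ey'; split=> //; first by rewrite Ey mulKg.
by rewrite Ey0 L Lb addn0.
Qed.

(** Let a v be shortest in m v W_J, so that len m <= len a by the choice of m, and put m v = a v b.
    Then len(av) + len b = len(mv) <= len m + len v <= len(av), which forces b = 1. *)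
Lemma left_coset_repsP m : left_coset_reps gen K J v m ->
  double_coset_reps gen finset.set0 J (m * v) /\ len (m * v) = (len m + len v)%N.
Proof.
move=> [Km Hm].
have [a [Ka Ra Ja La]] := coset_factor (double_coset_mull J v Km).
suff -> : m = a by [].
have Jm : parabolic gen J (v^-1 * (m^-1 * a) * v).
  by move: Ja; rewrite invgM !mulgA.
have := Hm _ (parabolicM (parabolicV Km) Ka) Jm; rewrite mulVKg => Lma.
pose b := (a * v)^-1 * (m * v).
have Jb : parabolic gen J b by rewrite -[b]invgK /b invgM invgK; apply: parabolicV.
have := min_coset_len Ra Jb; rewrite /b mulVKg -/b => E.
have := lenM m v; rewrite E La => H.
have : (len a + len v + len b <= len a + len v)%N.
  by apply: leq_trans H _; rewrite leq_add2r.
rewrite -[X in (_ <= X)%N]addn0 leq_add2l leqn0 => /eqP/len_eq0 b1.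
apply: (@mulIg _ v); have : a * v * b = m * v by rewrite /b mulVKg.
by rewrite b1 mulg1.
Qed.

(** The factor a of [coset_factor] is in M_K(J,v): for y in the intersection of W_K and v W_J v^-1,
    a y v lies in a v W_J, so len a + len v <= len(ayv) <= len(ay) + len v. *)
Lemma left_coset_reps_exists z : double_coset gen K v J z ->
  exists2 m, left_coset_reps gen K J v m & parabolic gen J (z^-1 * (m * v)).
Proof.
move=> Dz; have [a [Ka Ra Ja La]] := coset_factor Dz.
exists a => //; split=> // y Ky Jy; rewrite -(leq_add2r (len v)) -La.
apply: leq_trans (lenM _ _); apply: Ra.
exists 1, (v^-1 * y * v); split=> //; first exact: parabolic1.
by rewrite mul1g !mulgA mulgK.
Qed.

Lemma left_coset_reps_uniq m m' : left_coset_reps gen K J v m ->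
  left_coset_reps gen K J v m' -> parabolic gen J ((m * v)^-1 * (m' * v)) -> m = m'.
Proof.
move=> /left_coset_repsP[R _] /left_coset_repsP[R' _] Jb; apply: (@mulIg _ v).
apply: double_coset_reps_uniq R R' _.
by rewrite -[m' * v](mulVKg (m * v)); apply: double_coset_mulr.
Qed.

End LeftCosetReps.
End Coxeter.

(** * Apartments and the Weyl distance *)

Section CoxeterComplex.
Local Open Scope group_scope.
Variables (W : groupType) (S : finType) (gen : S -> W).
Hypothesis hW : coxeter_system gen.
Implicit Types (I J K : {set S}) (u v w : W).
Local Notation val := (word_val gen).
Local Notation len := (cox_length gen).
Local Notation coset := (std_coset gen).

Lemma std_cosetP w I z : coset w I z <-> parabolic gen I (w^-1 * z).
Proof.
split=> [[y Iy <-]|Iz]; first by rewrite mulKg.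
by exists (w^-1 * z) => //; rewrite mulVKg.
Qed.

Lemma std_cosetxx w I : coset w I w.
Proof. by apply/std_cosetP; rewrite mulVg; apply: parabolic1. Qed.

Lemma std_coset_eq w z I : parabolic gen I (w^-1 * z) -> coset w I = coset z I.
Proof.
move=> H; apply/seteqP; split=> y /std_cosetP Hy; apply/std_cosetP.
  have -> : z^-1 * y = (w^-1 * z)^-1 * (w^-1 * y).
    by rewrite invgM invgK !mulgA mulgK.
  by apply: parabolicM => //; apply: parabolicV.
have -> : w^-1 * y = (w^-1 * z) * (z^-1 * y) by rewrite !mulgA mulgK.
exact: parabolicM.
Qed.

Lemma std_coset_in w z I : coset w I z -> coset w I = coset z I.
Proof. by move/std_cosetP; apply: std_coset_eq. Qed.

Lemma std_coset0 w : coset w finset.set0 = [set w].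
Proof.
apply/seteqP; split=> y; last by move=> ->; apply: std_cosetxx.
by move/std_cosetP/parabolic0/mulg1_eq; rewrite invgK => ->.
Qed.

Lemma std_coset_gen w I s : coset w I (w * gen s) <-> s \in I.
Proof.
rewrite std_cosetP mulKg; exact: parabolic_gen hW I s.
Qed.

Lemma std_coset_sub w I J : coset w I `<=` coset w J <-> (I \subset J)%SET.
Proof.
split=> [H|/fintype.subsetP H y /std_cosetP[x xI Ex]]; last first.
  by apply/std_cosetP; exists x => // s /xI/H.
apply/fintype.subsetP => s; rewrite -!(std_coset_gen w); exact: H.
Qed.

Lemma std_coset_inj w z I J : coset w I = coset z J -> I = J.
Proof.
move=> E; have zw : coset z J w by rewrite -E; apply: std_cosetxx.
rewrite (std_coset_in zw) in E.
apply/eqP; rewrite finset.eqEsubset.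
by apply/andP; split; apply/(std_coset_sub w); rewrite E.
Qed.

Lemma coxeter_complex_coset w I : coxeter_complex gen (coset w I).
Proof. by exists w, I. Qed.

Lemma coxeter_complex_in (A : set W) w : coxeter_complex gen A -> A w ->
  exists I, A = coset w I.
Proof. by move=> [z [I ->]] /std_coset_in ->; exists I. Qed.

(** Induction along a gallery: once the faces of the chamber c are sent to the faces of d with the
    same cotypes, the same follows for cs and ds. *)
Lemma coxeter_complex_rigid (psi : set W -> set W) (a b : W) :
    (forall A, coxeter_complex gen A -> coxeter_complex gen (psi A)) ->
    (forall A B, coxeter_complex gen A -> coxeter_complex gen B ->
      (A `<=` B <-> psi A `<=` psi B)) ->
    (forall I, psi (coset a I) = coset b I) ->
  forall x I, psi (coset (a * x) I) = coset (b * x) I.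
Proof.
move=> psiC psiS psi1 x; have [z <-] := cox_generate hW x; rewrite -/(val z).
elim/last_ind: z => [|z s IH] I; first by rewrite val_nil !mulg1.
rewrite -cats1 val_cat val_seq1 !mulgA.
set c := a * val z; set d := b * val z; rewrite -/c -/d in IH.
have psiU x1 I1 x2 I2 : coset x1 I1 `<=` coset x2 I2 ->
    psi (coset x1 I1) `<=` psi (coset x2 I2).
  have C := coxeter_complex_coset; exact: (psiS _ _ (C _ _) (C _ _)).1.
have psiD x1 I1 x2 I2 : psi (coset x1 I1) `<=` psi (coset x2 I2) ->
    coset x1 I1 `<=` coset x2 I2.
  have C := coxeter_complex_coset; exact: (psiS _ _ (C _ _) (C _ _)).2.
(* The chambers e and es share their faces of cotype containing s. *)
have shift (e : W) (L : {set S}) : s \in L -> coset (e * gen s) L = coset e L.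
  by move=> sL; apply/esym/std_coset_in/std_coset_gen.
(* The image of {cs} lies in the panel {d, ds} and, as [psi] reflects inclusions, does not contain
   d. *)
have base : psi (coset (c * gen s) finset.set0) = [set d * gen s].
  have [e [L E]] := psiC _ (coxeter_complex_coset (c * gen s) finset.set0).
  have s1 : s \in [set s]%SET by rewrite inE.
  have H : coset e L `<=` coset d [set s]%SET.
    rewrite -E -IH -(shift c) //; apply: psiU.
    by apply/std_coset_sub; apply: finset.sub0set.
  have N : ~ coset e L d.
    move=> Hd; have : coset c finset.set0 `<=` coset (c * gen s) finset.set0.
      apply: psiD; by rewrite IH E std_coset0 => _ ->.
    move/(_ c (std_cosetxx _ _)); rewrite std_coset0 /= => /esym/(canRL (mulKg _)).
    by rewrite mulVg; apply: cox_neq1 hW s.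
  have H' y : coset e L y -> y = d * gen s.
    move=> Hy; have /std_cosetP/(parabolic_set1 hW)[E1|E1] := H _ Hy.
      by case: N; rewrite -(mulg1 d) -E1 mulVKg.
    by rewrite -E1 mulVKg.
  rewrite E; apply/seteqP; split=> y; first exact: H'.
  by move=> ->; rewrite -(H' e) //; apply: std_cosetxx.
have [L E] : exists L, psi (coset (c * gen s) I) = coset (d * gen s) L.
  apply: coxeter_complex_in; first exact/psiC/coxeter_complex_coset.
  have : [set d * gen s] `<=` psi (coset (c * gen s) I); last by apply.
  rewrite -base; apply: psiU.
  by apply/std_coset_sub; apply: finset.sub0set.
have [sI|sI] := boolP (s \in I); first by rewrite !shift // IH.
(* For s outside I, adding s to a cotype gives a face of c, where [psi] is known. This pins L to I
   up to s, and s in L would put c in cs W_I. *)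
have sU M : s \in (s |: M)%SET by rewrite !inE eqxx.
have LsI : (L \subset s |: I)%SET.
  apply/(std_coset_sub (d * gen s)).
  rewrite -E (shift d) // -IH -(shift c) //.
  apply: psiU.
  by apply/std_coset_sub; apply: finset.subsetUr.
have IsL : (I \subset s |: L)%SET.
  apply/(std_coset_sub (c * gen s)); apply: psiD.
  rewrite E (shift c) // IH -(shift d) //.
  by apply/std_coset_sub; apply: finset.subsetUr.
have sL : s \notin L.
  apply/negP => sL; move/negP: sI; apply.
  have : coset c finset.set0 `<=` coset (c * gen s) I.
    apply: psiD.
    by rewrite IH E shift // std_coset0 => _ ->; apply: std_cosetxx.
  move/(_ c (std_cosetxx _ _)); rewrite -{2}(genK hW s c).
  by move/std_coset_gen.
rewrite E; congr (coset _ _); apply/setP => t.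
move/fintype.subsetP/(_ t): LsI; move/fintype.subsetP/(_ t): IsL; rewrite !inE.
case: eqVneq => [->|_] /=; first by rewrite (negPf sL) (negPf sI).
by move=> H1 H2; apply/idP/idP.
Qed.

End CoxeterComplex.

(** * The Weyl distance between chambers *)

Section WeylDistance.
Local Open Scope group_scope.
Variables (W : groupType) (S : finType) (gen : S -> W).
Hypothesis hW : coxeter_system gen.
Variable X : building gen.
Implicit Types (A B C D E P : {fset vertex X}) (I J K : {set S}) (u v w : W).
Local Notation val := (word_val gen).
Local Notation len := (cox_length gen).
Local Notation coset := (std_coset gen).
Local Notation "A <=f B" := (fsubset A B) (at level 70).

Local Notation chamber := (@chamber W S gen X).
Local Notation cotype_simplices := (@cotype_simplices W S gen X).

Section InApartment.
Variables (Sg : set {fset vertex X}) (phi : {fset vertex X} -> set W).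
Hypotheses (hSg : apartment Sg) (hphi : coxeter_iso gen Sg phi).

Lemma iso_le A B : Sg A -> Sg B -> (A <=f B <-> phi B `<=` phi A).
Proof. by case: hphi => _ H _; apply: H. Qed.

Lemma iso_inj A B : Sg A -> Sg B -> phi A = phi B -> A = B.
Proof. by case: hphi => -[_ + _] _ _ => H SA SB; apply: H; rewrite inE. Qed.

Lemma iso_surj F : coxeter_complex gen F -> exists2 A, Sg A & phi A = F.
Proof. by case: hphi => -[_ _ H] _ _ /H. Qed.

Lemma iso_complex A : Sg A -> coxeter_complex gen (phi A).
Proof. by case: hphi => -[H _ _] _ _ /H. Qed.

Lemma iso_coset A a : Sg A -> phi A a -> phi A = coset a (cotype A).
Proof. by case: hphi => _ _ H /H[w ->] /(std_coset_in hW). Qed.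

Lemma iso_cotype A a I : Sg A -> phi A = coset a I -> cotype A = I.
Proof.
move=> SA E; apply: (std_coset_inj hW (w := a) (z := a)).
by rewrite -E -iso_coset // E; apply: std_cosetxx.
Qed.

Lemma apartment_face A B : Sg B -> A <=f B -> Sg A.
Proof. by have [_ _ H] := apartment_sub hSg => SB; apply: H. Qed.

Lemma apartment_simplex A : Sg A -> simplex A.
Proof. by have [H _ _] := apartment_sub hSg; apply: H. Qed.

End InApartment.

Lemma cotypeP A s : reflect (exists2 a, a \in A & vtype a = s) (s \notin cotype A).
Proof.
rewrite /cotype !inE negbK; apply: (iffP mapP) => -[a Aa E]; first by exists a.
by exists a.
Qed.

(** Such a simplex has a vertex of every type, so by injectivity of types a larger simplex has no
    further vertex. *)
Lemma cotype0_chamber C : simplex C -> cotype C = finset.set0 -> chamber C.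
Proof.
move=> sC C0; split=> // A sA CA; apply/eqP; rewrite eqEfsubset CA andbT.
apply/fsubsetP => x Ax.
have /cotypeP[c Cc E] : vtype x \notin cotype C by rewrite C0 inE.
by rewrite -(vtype_inj sA (fsubsetP CA _ Cc) Ax E).
Qed.

(** A chamber with image a W_I is a face of the simplex with image {a}, hence equals it by
    maximality. *)
Lemma apartment_chamber Sg phi C : apartment Sg -> coxeter_iso gen Sg phi -> Sg C ->
  (chamber C <-> exists a, phi C = [set a]).
Proof.
move=> hSg hphi SC; split=> [[_ Cmax]|[a E]]; last first.
  apply: cotype0_chamber; first exact: apartment_simplex SC.
  by apply: (iso_cotype hphi SC (a := a)); rewrite std_coset0.
have [a [I E]] := iso_complex hphi SC; exists a.
have [D SD ED] := iso_surj hphi (coxeter_complex_coset gen a finset.set0).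
rewrite std_coset0 in ED; rewrite -(Cmax D) //.
  exact: apartment_simplex SD.
by apply/(iso_le hphi SC SD); rewrite ED E => _ ->; apply: std_cosetxx.
Qed.

Lemma apartment_pair A B : simplex A -> simplex B ->
  exists Sg phi, [/\ apartment Sg, coxeter_iso gen Sg phi, Sg A & Sg B].
Proof.
move=> sA sB; have [Sg [hSg SA SB]] := apartment_common sA sB.
by have [phi hphi] := apartment_coxeter hSg; exists Sg, phi.
Qed.

Lemma chamber_simplex C : chamber C -> simplex C. Proof. by case. Qed.

Lemma chamber_cotype C : chamber C -> cotype C = finset.set0.
Proof.
move=> cC; have [Sg [phi [hSg hphi SC _]]] :=
  apartment_pair (chamber_simplex cC) (chamber_simplex cC).
have [a E] := (apartment_chamber hSg hphi SC).1 cC.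
by apply: (iso_cotype hphi SC (a := a)); rewrite std_coset0.
Qed.

(* Transporting an isomorphism between apartments through phi and phi' gives an
   automorphism of the Coxeter complex that preserves the types of the faces of
   the chamber phi C, hence is a left translation. *)
Lemma apartment_coset Sg phi Sg' phi' C P a b y y' :
    apartment Sg -> coxeter_iso gen Sg phi -> apartment Sg' -> coxeter_iso gen Sg' phi' ->
    Sg C -> Sg P -> Sg' C -> Sg' P -> phi C = [set a] -> phi' C = [set b] ->
    phi P (a * y) -> phi' P (b * y') ->
  parabolic gen (cotype P) (y^-1 * y').
Proof.
move=> hSg hphi hSg' hphi' SC SP SC' SP' EC EC' EP EP'.
have [f [[[f1 f2 f3] fle] ffix]] := apartment_iso hSg hSg' SC SP SC' SP'.
(* [g] inverts [phi]; the default [fset0] is never reached on a standard coset. *)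
pose g F := xget fset0 [set A | Sg A /\ phi A = F].
have gphi A : Sg A -> g (phi A) = A.
  move=> SA; apply: xget_unique => // B [SB E]; exact: iso_inj hphi _ _ SB SA E.
pose psi F := phi' (f (g F)).
have psiE A : Sg A -> psi (phi A) = phi' (f A) by move=> SA; rewrite /psi gphi.
have trans := @coxeter_complex_rigid _ _ _ hW psi a b.
have E : psi (coset (a * y) (cotype P)) = coset (b * y) (cotype P).
  apply: trans => [F|F F'|I].
  - move=> /(iso_surj hphi)[A SA <-]; rewrite psiE //.
    by apply: (iso_complex hphi'); apply: f1.
  - move=> /(iso_surj hphi)[A SA <-] /(iso_surj hphi)[B SB <-]; rewrite !psiE //.
    rewrite -(iso_le hphi SB SA) -(iso_le hphi' (f1 _ SB) (f1 _ SA)).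
    by rewrite fle.
  - have [D SD ED] := iso_surj hphi (coxeter_complex_coset gen a I).
    have DC : D <=f C.
      by apply/(iso_le hphi SD SC); rewrite EC ED => _ ->; apply: std_cosetxx.
    have SD' := apartment_face hSg' SC' DC.
    rewrite -ED psiE // ffix ?DC // -(iso_cotype hphi SD ED).
    apply: (iso_coset hphi' SD').
    have : phi' C `<=` phi' D by apply/(iso_le hphi' SD' SC').
    by rewrite EC'; apply.
rewrite -(iso_coset hphi SP EP) psiE // ffix ?fsubset_refl ?orbT // in E.
have : coset (b * y) (cotype P) (b * y') by rewrite -E.
by move/std_cosetP; rewrite invgM -mulgA mulKg.
Qed.

(** Two candidate values differ by an element of the parabolic subgroup of the empty cotype of D,
    which is trivial, so the choice made by [xget] is forced. *)
Lemma weyl_dist_apartment Sg phi C D a b : apartment Sg -> coxeter_iso gen Sg phi ->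
  Sg C -> Sg D -> phi C = [set a] -> phi D = [set b] -> weyl_dist C D = a^-1 * b.
Proof.
move=> hSg hphi SC SD EC ED; apply: xget_unique.
  by exists Sg, phi, a; rewrite mulVKg; split.
move=> w [Sg' [phi' [a' [hSg' hphi' [SC' SD'] EC' ED']]]].
have : parabolic gen (cotype D) ((a^-1 * b)^-1 * w).
  apply: (apartment_coset hSg hphi hSg' hphi' SC SD SC' SD' EC EC').
    by rewrite ED mulVKg.
  by rewrite ED'.
rewrite (iso_cotype hphi SD (a := b) (I := finset.set0)) ?std_coset0 //.
by move/parabolic0/mulg1_eq; rewrite invgK.
Qed.

Lemma weyl_apartment C D : chamber C -> chamber D -> exists Sg phi a,
  [/\ apartment Sg, coxeter_iso gen Sg phi, Sg C /\ Sg D, phi C = [set a] &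
      phi D = [set a * weyl_dist C D]].
Proof.
move=> cC cD; have [Sg [phi [hSg hphi SC SD]]] :=
  apartment_pair (chamber_simplex cC) (chamber_simplex cD).
have [a Ea] := (apartment_chamber hSg hphi SC).1 cC.
have [b Eb] := (apartment_chamber hSg hphi SD).1 cD.
exists Sg, phi, a; split=> //.
by rewrite (weyl_dist_apartment hSg hphi SC SD Ea Eb) mulVKg.
Qed.

Lemma weyl_distV C D : chamber C -> chamber D -> weyl_dist D C = (weyl_dist C D)^-1.
Proof.
move=> cC cD; have [Sg [phi [a [hSg hphi [SC SD] EC ED]]]] := weyl_apartment cC cD.
by rewrite (weyl_dist_apartment hSg hphi SD SC ED EC) invgM mulgVK.
Qed.

Lemma weyl_dist_eq1 C D : chamber C -> chamber D -> weyl_dist C D = 1 <-> C = D.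
Proof.
move=> cC cD; have [Sg [phi [a [hSg hphi [SC SD] EC ED]]]] := weyl_apartment cC cD.
split=> [E|<-]; first by rewrite E mulg1 -EC in ED; apply/esym/(iso_inj hphi SD SC ED).
by rewrite (weyl_dist_apartment hSg hphi SC SC EC EC) mulVg.
Qed.

(** E is taken in an apartment containing C and D, where both distances can be read off. *)
Lemma weyl_extend C D z : chamber C -> chamber D -> exists E,
  [/\ chamber E, weyl_dist D E = z & weyl_dist C E = weyl_dist C D * z].
Proof.
move=> cC cD; have [Sg [phi [a [hSg hphi [SC SD] EC ED]]]] := weyl_apartment cC cD.
have [E SE EE] := iso_surj hphi
  (coxeter_complex_coset gen (a * weyl_dist C D * z) finset.set0).
rewrite std_coset0 in EE; exists E.
rewrite (weyl_dist_apartment hSg hphi SC SE EC EE).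
rewrite (weyl_dist_apartment hSg hphi SD SE ED EE); split.
- by apply/(apartment_chamber hSg hphi SE); exists (a * weyl_dist C D * z).
- by rewrite mulKg.
- by rewrite -mulgA mulKg.
Qed.

Lemma weyl_split C E y z : chamber C -> chamber E -> weyl_dist C E = y * z ->
  exists D, [/\ chamber D, weyl_dist C D = y & weyl_dist D E = z].
Proof.
move=> cC cE Eyz; have [D [cD E1 E2]] := weyl_extend z^-1 cC cE.
exists D; split=> //; first by rewrite E2 Eyz mulgK.
by rewrite (weyl_distV cE cD) E1 invgK.
Qed.

(** * Faces, residues and galleries *)

Definition face E J : {fset vertex X} := [fset x in E | vtype x \notin J]%fset.

Lemma face_sub E J : face E J <=f E.
Proof. by apply/fsubsetP => x; rewrite !inE => /andP[]. Qed.

Lemma face_cotype E J : chamber E -> cotype_simplices J (face E J).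
Proof.
move=> cE; split; first exact: simplex_face (chamber_simplex cE) (face_sub E J).
apply/setP => s; apply/idP/idP; last first.
  by apply: contraTT => /cotypeP[a]; rewrite !inE => /andP[_ +] <-.
apply: contraTT => sJ; apply/cotypeP.
have /cotypeP[a Ea Es] : s \notin cotype E by rewrite chamber_cotype // inE.
by exists a => //; rewrite !inE Ea Es.
Qed.

Lemma face_unique E J D : chamber E -> cotype_simplices J D -> D <=f E -> D = face E J.
Proof.
move=> cE [sD EJ] DE; apply/fsetP => x; rewrite !inE -EJ; apply/idP/andP.
  move=> Dx; split; first exact: fsubsetP DE _ Dx.
  by apply/cotypeP; exists x.
move=> [Ex /cotypeP[d Dd Ed]].
by rewrite -(vtype_inj (chamber_simplex cE) (fsubsetP DE _ Dd) Ex Ed).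
Qed.

(** In an apartment where E is {a}, its face is a W_J, and E' shares this face exactly when it lies
    in a W_J. *)
Lemma weyl_residue E E' J : chamber E -> chamber E' ->
  parabolic gen J (weyl_dist E E') <-> face E J = face E' J.
Proof.
move=> cE cE'; have [Sg [phi [a [hSg hphi [SE SE'] HE HE']]]] := weyl_apartment cE cE'.
have coset_face D b : chamber D -> Sg D -> phi D = [set b] ->
    Sg (face D J) /\ phi (face D J) = coset b J.
  move=> cD SD ED; have SF := apartment_face hSg SD (face_sub D J).
  split=> //; rewrite (iso_coset hphi SF (a := b)); last first.
    by have /(iso_le hphi SF SD) := face_sub D J; rewrite ED; apply.
  by have [_ ->] := face_cotype J cD.
have [SF EF] := coset_face _ _ cE SE HE.
have [SF' EF'] := coset_face _ _ cE' SE' HE'.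
split=> [H|H].
  apply: face_unique => //; first exact: face_cotype.
  apply/(iso_le hphi SF SE'); rewrite HE' EF => _ ->.
  by apply/std_cosetP; rewrite mulKg.
have : coset a J (a * weyl_dist E E') by rewrite -EF H EF'; apply: std_cosetxx.
by move/std_cosetP; rewrite mulKg.
Qed.

(** D and E share their face of cotype J; [apartment_coset] compares its position relative to C in
    an apartment through C and D and in one through C and E. *)
Lemma weyl_dist_coset C D E J : chamber C -> chamber D -> chamber E ->
  parabolic gen J (weyl_dist D E) ->
  parabolic gen J ((weyl_dist C D)^-1 * weyl_dist C E).
Proof.
move=> cC cD cE /(weyl_residue J cD cE) EF.
have [Sg [phi [a [hSg hphi [SC SD] HC HD]]]] := weyl_apartment cC cD.
have [Sg' [phi' [a' [hSg' hphi' [SC' SE'] HC' HE']]]] := weyl_apartment cC cE.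
have SF := apartment_face hSg SD (face_sub D J).
have SF' := apartment_face hSg' SE' (face_sub E J).
have EJ : cotype (face D J) = J by have [] := face_cotype J cD.
rewrite -{1}EJ.
apply: (apartment_coset hSg hphi hSg' hphi' SC SF SC' _ HC HC').
- by rewrite EF.
- by have /(iso_le hphi SF SD) := face_sub D J; rewrite HD; apply.
- rewrite EF; have /(iso_le hphi' SF' SE') := face_sub E J.
  by rewrite HE'; apply.
Qed.

Lemma weyl_dist_step C D E s : chamber C -> chamber D -> chamber E ->
  weyl_dist D E = gen s ->
  weyl_dist C E = weyl_dist C D \/ weyl_dist C E = weyl_dist C D * gen s.
Proof.
move=> cC cD cE Es; have : parabolic gen [set s]%SET (weyl_dist D E).
  by rewrite Es; apply/(parabolic_gen hW); rewrite inE.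
move/(weyl_dist_coset cC cD cE)/(parabolic_set1 hW) => [] H; [left|right].
  by rewrite -[RHS]mulg1 -H mulVKg.
by rewrite -H mulVKg.
Qed.

(** Follow a gallery of type x from C to E, seen from D: each letter is either multiplied in or
    skipped. *)
Lemma weyl_dist_subword C D E x : chamber C -> chamber D -> chamber E ->
  weyl_dist C E = val x ->
  exists2 y, subseq y x & weyl_dist D E = weyl_dist D C * val y.
Proof.
move=> + cD cE; elim: x C => [|s x IH] C cC.
  rewrite val_nil => /(weyl_dist_eq1 cC cE) ->.
  by exists [::]; rewrite // val_nil mulg1.
rewrite val_cons => /(weyl_split cC cE)[C1 [cC1 Es Ex]].
have [y sub E1] := IH C1 cC1 Ex.
have [E2|E2] := weyl_dist_step cD cC cC1 Es.
  exists y; last by rewrite E1 E2.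
  exact: subseq_trans sub (subseq_cons _ _).
exists (s :: y); first by rewrite /= eqxx.
by rewrite E1 E2 val_cons mulgA.
Qed.

(* If D and E were both at distance w from C, a gallery of reduced type w from C
   to E, seen from D, would write w * gen s with at most len w letters. *)
Lemma weyl_dist_up C D E s : chamber C -> chamber D -> chamber E ->
  weyl_dist D E = gen s -> (len (weyl_dist C D) < len (weyl_dist C D * gen s))%N ->
  weyl_dist C E = weyl_dist C D * gen s.
Proof.
move=> cC cD cE Es Hlen; have [H|//] := weyl_dist_step cC cD cE Es.
have [x Ex Sx] := reduced_word hW (weyl_dist C D).
have [y sub Ey] := weyl_dist_subword cC cD cE (etrans H (esym Ex)).
rewrite Es (weyl_distV cC cD) in Ey.
move: Hlen; rewrite Ey mulVKg ltnNge -Sx.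
by rewrite (leq_trans (len_le hW _)) // size_subseq.
Qed.

(** D moves towards E along a reduced gallery; additivity of lengths makes every step an ascent seen
    from C, so [weyl_dist_up] applies. *)
Lemma weyl_distM C D E : chamber C -> chamber D -> chamber E ->
  len (weyl_dist C D * weyl_dist D E) = (len (weyl_dist C D) + len (weyl_dist D E))%N ->
  weyl_dist C E = weyl_dist C D * weyl_dist D E.
Proof.
move=> cC + cE; have [x Ex Sx] := reduced_word hW (weyl_dist D E).
move: D E Ex Sx cE.
elim: x => [|s x IH] D E Ex Sx cE cD.
  rewrite -Ex val_nil mulg1; move/esym: Ex; rewrite val_nil => /(weyl_dist_eq1 cD cE) ->.
  by [].
rewrite -Sx -Ex => L.
have [D1 [cD1 Es Ex1]] := weyl_split cD cE (etrans (esym Ex) (val_cons _ _ _)).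
have Lx : size x = len (val x) by rewrite (reduced_cons hW (s := s)) // Ex -Sx.
(* If the first letter were not an ascent, the remaining [size x] letters could not reach the full
   length. *)
have L1 : len (weyl_dist C D * gen s) = (len (weyl_dist C D)).+1.
  apply/eqP; rewrite eqn_leq -addn1; apply/andP; split.
    rewrite (leq_trans (lenM hW _ _)) // leq_add2l -val_seq1.
    exact: len_le.
  rewrite -(leq_add2r (size x)) -addnA add1n -[(size x).+1]/(size (s :: x)) -L.
  by rewrite val_cons mulgA Lx lenM.
have E1 : weyl_dist C D1 = weyl_dist C D * gen s by apply: weyl_dist_up; rewrite ?L1.
rewrite val_cons mulgA -E1 -Ex1; apply: IH => //; first by rewrite Ex1.
by rewrite Ex1 E1 L1 -mulgA -val_cons L /= addnS -Lx.
Qed.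

Lemma weyl_dist_cons C D E s x : chamber C -> chamber D -> chamber E ->
  weyl_dist C D = gen s -> weyl_dist D E = val x ->
  len (val (s :: x)) = (size x).+1 -> weyl_dist C E = val (s :: x).
Proof.
move=> cC cD cE Es Ex red; rewrite val_cons -Es -Ex; apply: weyl_distM => //.
by rewrite Es Ex -val_cons red (len_gen hW) (reduced_cons hW red).
Qed.

End WeylDistance.

(** * The distance between simplices *)

Section SimplexDistance.
Local Open Scope group_scope.
Variables (W : groupType) (S : finType) (gen : S -> W).
Hypothesis hW : coxeter_system gen.
Variable X : building gen.
Implicit Types (A B C D E P : {fset vertex X}) (I J K : {set S}) (u v w : W).

Lemma simplex_chamber A : simplex A -> exists C, chambers_of A C.
Proof.
move=> sA; have [Sg [phi [hSg hphi SA _]]] := apartment_pair sA sA.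
have [a [I E]] := iso_complex hphi SA.
have [C SC EC] := iso_surj hphi (coxeter_complex_coset gen a finset.set0).
rewrite std_coset0 in EC; exists C; split.
  by apply/(apartment_chamber hW hSg hphi SC); exists a.
by apply/(iso_le hphi SA SC); rewrite EC E => _ ->; apply: std_cosetxx.
Qed.

Lemma chambers_of_face A C : simplex A -> chambers_of A C -> A = face C (cotype A).
Proof. by move=> sA [cC AC]; exact: face_unique. Qed.

Lemma chambers_of_residue A C D : simplex A -> chambers_of A C -> chamber D ->
  chambers_of A D <-> parabolic gen (cotype A) (weyl_dist C D).
Proof.
move=> sA hC cD; have cC := hC.1.
rewrite (weyl_residue hW _ cC cD) -(chambers_of_face sA hC).
split=> [hD|->]; first exact: chambers_of_face.
by split=> //; apply: face_sub.
Qed.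

(** One end is changed at a time: E to E' seen from C, then C to C' seen from E'. *)
Lemma chambers_of_double_coset A B C C' E E' : simplex A -> simplex B ->
  chambers_of A C -> chambers_of A C' -> chambers_of B E -> chambers_of B E' ->
  double_coset gen (cotype A) (weyl_dist C E) (cotype B) (weyl_dist C' E').
Proof.
move=> sA sB hC hC' hE hE'; have [cC cC' cE cE'] := And4 hC.1 hC'.1 hE.1 hE'.1.
have HJ := weyl_dist_coset hW cC cE cE' ((chambers_of_residue sB hE cE').1 hE').
have HI := weyl_dist_coset hW cE' cC cC' ((chambers_of_residue sA hC cC').1 hC').
rewrite (weyl_distV hW cC cE') (weyl_distV hW cC' cE') invgK in HI.
exists (weyl_dist C E' * (weyl_dist C' E')^-1)^-1, ((weyl_dist C E)^-1 * weyl_dist C E').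
split=> //; first exact: (parabolicV hW).
by rewrite invgM invgK -!mulgA mulVKg mulVg mulg1.
Qed.

(** Extend by b at E and by a^-1 at C; neither move leaves the chambers of the given simplices. *)
Lemma chambers_of_attain A B C E r : simplex A -> simplex B ->
  chambers_of A C -> chambers_of B E ->
  double_coset gen (cotype A) (weyl_dist C E) (cotype B) r ->
  exists C' E', [/\ chambers_of A C', chambers_of B E' & weyl_dist C' E' = r].
Proof.
move=> sA sB hC hE [a [b [Ha Hb ->]]]; have [cC cE] := (hC.1, hE.1).
have [E' [cE' Eb ECE']] := weyl_extend hW b cC cE.
have [C' [cC' Ea EC']] := weyl_extend hW a^-1 cE' cC.
exists C', E'; split.
- by apply/(chambers_of_residue sA hC cC'); rewrite Ea; apply: (parabolicV hW).
- by apply/(chambers_of_residue sB hE cE'); rewrite Eb.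
rewrite (weyl_distV hW cE' cC') EC' (weyl_distV hW cC cE') ECE'.
by rewrite invgM !invgK mulgA.
Qed.

(** The distances between chambers of A and of B fill exactly one double coset, and [xget] picks its
    unique shortest element. Hence a distance can be tested on any one pair of chambers. *)
Lemma simplex_distE A B C E r : simplex A -> simplex B ->
  chambers_of A C -> chambers_of B E ->
  double_coset_reps gen (cotype A) (cotype B) r ->
  simplex_dist A B = r <->
  double_coset gen (cotype A) r (cotype B) (weyl_dist C E).
Proof.
move=> sA sB hC hE Rr.
have [t Rt Dt] := double_coset_reps_exists gen (cotype A) (cotype B) (weyl_dist C E).
have -> : simplex_dist A B = t.
  apply: xget_unique.
    by split=> //; apply: (chambers_of_attain sA sB hC hE).
  move=> z [Rz [C' [E' [hC' hE' Ez]]]].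
  apply/esym/(double_coset_reps_uniq hW Rt Rz).
  apply: double_coset_trans (double_coset_sym hW Dt) _.
  by rewrite -Ez; apply: chambers_of_double_coset.
split=> [<-|D]; first exact: double_coset_sym.
apply: (double_coset_reps_uniq hW Rt Rr).
exact/(double_coset_sym hW)/(double_coset_trans D Dt).
Qed.

Lemma simplex_dist_attained A B : simplex A -> simplex B ->
  exists C E, [/\ chambers_of A C, chambers_of B E & weyl_dist C E = simplex_dist A B].
Proof.
move=> sA sB; have [C hC] := simplex_chamber sA; have [E hE] := simplex_chamber sB.
have [t Rt Dt] := double_coset_reps_exists gen (cotype A) (cotype B) (weyl_dist C E).
have -> : simplex_dist A B = t.
  by apply/(simplex_distE sA sB hC hE Rt)/(double_coset_sym hW).
exact: (chambers_of_attain sA sB hC hE).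
Qed.

End SimplexDistance.

(** * Counting chambers and pregalleries *)

Section Enumeration.
Local Open Scope card_scope.

(** Cardinality is carried by a duplicate-free list, so that disjoint unions become
    concatenations. *)
Definition enumerates (T : eqType) (P : set T) (n : nat) : Prop :=
  exists l, [/\ uniq l, (forall x, P x <-> x \in l) & size l = n].

Lemma enumerates_bigcup (I T : eqType) (r : seq I) (P : I -> set T) (n : I -> nat) :
    uniq r -> (forall i, i \in r -> enumerates (P i) (n i)) ->
    (forall i j x, i \in r -> j \in r -> P i x -> P j x -> i = j) ->
  enumerates [set x | exists2 i, i \in r & P i x] (\sum_(i <- r) n i)%N.
Proof.
elim: r => [|i r IH] /= => [_ _ _|/andP[ir ur] En dis].
  by exists [::]; split=> //; [move=> x; split=> // -[]|rewrite big_nil].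
have [k kr|i1 j x i1r jr|l [ul lP sl]] := IH ur.
- by apply: En; rewrite inE kr orbT.
- by apply: dis; rewrite inE ?i1r ?jr orbT.
have [l' [ul' lP' sl']] := En i (mem_head _ _).
exists (l' ++ l); split; last by rewrite size_cat sl sl' big_cons.
  rewrite cat_uniq ul ul' andbT /=; apply/hasPn => x /lP[j jr Pj].
  apply/negP => /lP' Pi; move/negP: ir; apply.
  by rewrite (dis i j x) // inE ?eqxx // jr orbT.
move=> x; rewrite mem_cat; split=> [[j]|/orP[/lP'|/lP[j jr]] Px].
- rewrite inE => /orP[/eqP->|jr] Px; apply/orP; [left|right].
    by apply/lP'.
  by apply/lP; exists j.
- by exists i; rewrite ?mem_head.
- by exists j; rewrite // inE jr orbT.
Qed.

Lemma enumerates_image (T U : eqType) (P : set T) (Q : set U) (f : T -> U) n :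
    (forall x, P x -> Q (f x)) ->
    (forall x y, P x -> P y -> f x = f y -> x = y) ->
    (forall z, Q z -> exists2 x, P x & f x = z) ->
  enumerates P n -> enumerates Q n.
Proof.
move=> fQ finj fsurj [l [ul lP sl]]; exists (map f l); split.
- by rewrite map_inj_in_uniq // => x y /lP Px /lP Py; apply: finj.
- move=> z; split=> [/fsurj[x Px <-]|/mapP[x /lP Px ->]]; last exact: fQ.
  by apply/map_f/lP.
- by rewrite size_map.
Qed.

Lemma enumerates_card (T : choiceType) (P : set T) n : enumerates P n -> P #= `I_n.
Proof.
move=> [l [ul lP sl]].
have -> : P = [set` [fset x in l]%fset].
  by apply/seteqP; split=> x /=; rewrite inE => /lP.
by apply/card_eq_fsetP; rewrite card_fseq undup_id.
Qed.

Lemma card_enumerates (T : choiceType) (P : set T) n : P #= `I_n -> enumerates P n.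
Proof.
move=> Pn; have fP : finite_set P by apply/finite_setP; exists n.
exists (fset_set P); split; first exact: fset_uniq.
  by move=> x; rewrite in_fset_set // inE.
exact: card_fset_set.
Qed.

End Enumeration.

Section Count.
Local Open Scope group_scope.
Variables (W : groupType) (S : finType) (gen : S -> W).
Hypothesis hW : coxeter_system gen.
Implicit Types (I J K : {set S}) (u v w : W) (x : seq S) (p : seq (S * W)).
Local Notation val := (word_val gen).
Local Notation len := (cox_length gen).
Variables (q : S -> nat) (T : set W).

(** The recursion common to both sides: it computes the weighted sum of pregalleries of type x from
    w ending in [T] ([sum_pregalleries]) and a number of chambers ([count_chambers]). *)
Fixpoint weighted_count w x : nat :=
  if x is s :: x' then
    if (len w < len (w * gen s))%N then (q s * weighted_count (w * gen s) x')%N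
    else (weighted_count (w * gen s) x' + (q s - 1) * weighted_count w x')%N
  else `[<T w>].

(** * Listing and weighing pointed pregalleries *)

Section Pregalleries.

Fixpoint pregalleries w x : seq (seq (S * W)) :=
  if x is s :: x' then
    [seq (s, w * gen s) :: p | p <- pregalleries (w * gen s) x'] ++
    (if (len w < len (w * gen s))%N then [::]
     else [seq (s, w) :: p | p <- pregalleries w x'])
  else [:: [::]].

Lemma gen_neq w s : (w * gen s == w) = false.
Proof.
apply/negP => /eqP; rewrite -{2}(mulg1 w) => /mulgI; exact: cox_neq1 hW s.
Qed.

Lemma pregalleriesP w x p :
  (p \in pregalleries w x) = is_pointed_pregallery gen (w, p) && (map fst p == x).
Proof.
rewrite /is_pointed_pregallery /pg_steps /=.
elim: x w p => [|s x IH] w [|[t w'] p] //=; rewrite ?inE //= ?andbF //.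
  rewrite mem_cat; apply/norP; split; first by apply/mapP => -[].
  by case: ifP => // _; apply/mapP => -[].
have memc b (r : seq (seq (S * W))) :
    ((t, w') :: p \in [seq (s, b) :: p0 | p0 <- r]) =
    [&& t == s, w' == b & p \in r].
  apply/mapP/and3P => [[p0 Hp0 [-> -> ->]]|[/eqP-> /eqP-> Hp]]; last by exists p.
  by rewrite !eqxx.
have memc' (b : bool) (r : seq (seq (S * W))) :
    ((t, w') :: p \in (if b then [::] else [seq (s, w) :: p0 | p0 <- r])) =
    [&& ~~ b, t == s, w' == w & p \in r] by case: b; rewrite ?memc.
(* Pointed steps ask for a descent, the recursion for the failure of an ascent; these agree. *)
have lenE : (len (w * gen s) < len w)%N = ~~ (len w < len (w * gen s))%N.
  by apply/idP/idP => [H|/(len_genC hW)//]; rewrite -leqNgt ltnW.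
rewrite mem_cat memc memc' eqseq_cons.
have [->|_] := eqVneq t s; last by rewrite !andbF.
have [->|_] := eqVneq w' (w * gen s).
  by rewrite gen_neq [w == _]eq_sym gen_neq IH /= andbF orbF.
rewrite /= orbF [w == w']eq_sym; have [->|_] := eqVneq w' w; last by rewrite andbF.
by rewrite lenE IH /= andbA.
Qed.

Lemma pregalleries_uniq w x : uniq (pregalleries w x).
Proof.
elim: x w => [//|s x IH] w /=.
have cons_uniq b : uniq [seq (s, b) :: p0 | p0 <- pregalleries b x].
  by rewrite map_inj_uniq // => p p' [].
rewrite cat_uniq cons_uniq /=; case: ifP => //= _; rewrite cons_uniq andbT.
apply/hasPn => _ /mapP[p _ ->]; apply/negP => /mapP[p' _ [/esym/eqP]].
by rewrite gen_neq.
Qed.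

Lemma pg_weight_cons w s w' p : pg_weight gen q (w, (s, w') :: p) =
  (q s ^ (len w < len w')%N * (q s - 1) ^ (w' == w) * pg_weight gen q (w', p))%N.
Proof.
rewrite /pg_weight /pg_alpha /pg_sigma /pg_steps /=.
have prod1 (F : S -> nat) (b : bool) :
    (\prod_(t : S) F t ^ ((s == t) && b) = F s ^ b)%N.
  rewrite (bigD1 s) //= eqxx big1 ?muln1 // => t.
  by rewrite eq_sym => /negPf->; rewrite expn0.
rewrite -(prod1 q) -(prod1 (fun t => q t - 1)%N) -!big_split /=.
by apply: eq_bigr => t _; rewrite !expnD mulnACA.
Qed.

Lemma sum_pregalleries w x :
  (\sum_(p <- pregalleries w x | `[<T (pg_end (w, p))>]) pg_weight gen q (w, p))%N =
  weighted_count w x.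
Proof.
elim: x w => [|s x IH] w /=.
  rewrite big_cons big_nil /=; case: asboolP => // _.
  by rewrite /pg_weight big1 // => t _; rewrite !expn0.
rewrite big_cat big_map /=.
have step w' : (\sum_(p <- pregalleries w' x | `[<T (pg_end (w, (s, w') :: p))>])
    pg_weight gen q (w, (s, w') :: p) =
    q s ^ (len w < len w')%N * (q s - 1) ^ (w' == w) * weighted_count w' x)%N.
  by rewrite -IH big_distrr /=; apply: eq_bigr => p _; rewrite pg_weight_cons.
(* An ascent weighs [q s], a descent 1 and a stationary step [q s - 1]. *)
rewrite step gen_neq; case: ifP => [L|L].
  by rewrite big_nil addn0 expn1 expn0 muln1.
by rewrite big_map step ltnn eqxx !expn0 expn1 !mul1n.
Qed.

End Pregalleries.

(** * Counting chambers in a regular building *)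

Section Chambers.
Variable X : building gen.
Implicit Types (A B C D E P : {fset vertex X}).
Hypothesis hq : regular X q.

Lemma panel_neighbours D E s : chamber D -> chamber E ->
  chambers_of (face D [set s]%SET) E /\ E <> D <-> weyl_dist D E = gen s.
Proof.
move=> cD cE; have [sP cP] := face_cotype hW [set s]%SET cD.
have DP : chambers_of (face D [set s]%SET) D by split=> //; apply: face_sub.
have := chambers_of_residue hW sP DP cE; rewrite cP => ->; split.
  move=> [/(parabolic_set1 hW)[/(weyl_dist_eq1 hW cD cE) //|//]].
  by move=> ->.
move=> Es; split; first by rewrite Es; apply/(parabolic_gen hW); rewrite inE.
by move=> ED; apply: (cox_neq1 hW (s := s)); rewrite -Es; apply/(weyl_dist_eq1 hW).
Qed.

Lemma neighbours_card D s : chamber D ->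
  enumerates [set E | chamber E /\ weyl_dist D E = gen s] (q s).
Proof.
move=> cD; have [sP cP] := face_cotype hW [set s]%SET cD.
have [l [ul lP sl]] := card_enumerates (hq (conj sP cP)).
have Dl : D \in l by apply/lP; split=> //; apply: face_sub.
exists (rem D l); split; first exact: rem_uniq.
  move=> E; rewrite mem_rem_uniq // !inE; split.
    move=> [cE /(panel_neighbours s cD cE)[PE ED]].
    by apply/andP; split; [apply/eqP|apply/lP].
  move=> /andP[/eqP ED /lP PE]; have cE := PE.1; split=> //.
  by apply/(panel_neighbours s cD cE).
by rewrite size_rem // sl.
Qed.

(** E and E' lie in the same s-panel, so their distance is 1 or [gen s]. *)
Lemma neighbours_dist D E E' s : chamber D -> chamber E -> chamber E' ->
  weyl_dist D E = gen s -> weyl_dist D E' = gen s -> E <> E' -> weyl_dist E E' = gen s.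
Proof.
move=> cD cE cE' HE HE' NE.
have par E0 : weyl_dist D E0 = gen s -> parabolic gen [set s]%SET (weyl_dist D E0).
  by move=> ->; apply/(parabolic_gen hW); rewrite inE.
have EE : face E [set s]%SET = face E' [set s]%SET.
  by rewrite -(weyl_residue hW _ cD cE).1 ?(weyl_residue hW _ cD cE').1 //; apply: par.
have /(parabolic_set1 hW)[/(weyl_dist_eq1 hW cE cE')//|//] :=
  (weyl_residue hW _ cE cE').2 EE.
Qed.

Lemma weighted_count_sum C D s x (l : seq {fset vertex X}) :
    chamber C -> chamber D -> uniq l -> size l = q s ->
    (forall E, chamber E /\ weyl_dist D E = gen s <-> E \in l) ->
  (\sum_(E <- l) weighted_count (weyl_dist C E) x)%N =
  weighted_count (weyl_dist C D) (s :: x).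
Proof.
move=> cC cD ul sl lP /=.
have const (r : seq {fset vertex X}) w :
    (forall E, E \in r -> weyl_dist C E = w) ->
    (\sum_(E <- r) weighted_count (weyl_dist C E) x = size r * weighted_count w x)%N.
  move=> H; rewrite big_seq (eq_bigr (fun=> weighted_count w x)); last first.
    by move=> E /H ->.
  by rewrite -big_seq big_const_seq count_predT iter_addn addn0 mulnC.
case: ifP => [L|/negbT/(len_genC hW) L].
  rewrite (const _ (weyl_dist C D * gen s)) ?sl // => E /lP[cE Es].
  exact: weyl_dist_up L.
(* E1 is the neighbour closer to C. Every other neighbour is reached from E1 by an ascent, hence is
   as far from C as D. *)
have [E1 [cE1 Es EC]] := weyl_extend hW (gen s) cC cD.
have E1l : E1 \in l by apply/lP.
rewrite (big_rem E1) //= EC; congr (_ + _)%N.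
rewrite (const _ (weyl_dist C D)) ?size_rem ?sl ?subn1 // => E.
rewrite mem_rem_uniq // !inE => /andP[/eqP NE /lP[cE HE]].
have := weyl_dist_up hW cC cE1 cE (neighbours_dist cD cE1 cE Es HE (nesym NE)).
by rewrite EC (genK hW); apply.
Qed.

(** The chambers E are sorted by the first chamber D1 after D on a gallery of reduced type x from D
    to E. *)
Lemma count_chambers C D x : chamber C -> chamber D -> len (val x) = size x ->
  enumerates [set E | [/\ chamber E, weyl_dist D E = val x & T (weyl_dist C E)]]
    (weighted_count (weyl_dist C D) x).
Proof.
move=> cC; elim: x D => [|s x IH] D cD red.
  rewrite /= val_nil; have [TD|TD] := asboolP (T (weyl_dist C D)).
    exists [:: D]; split=> // E; rewrite inE; split.
      by move=> [cE /(weyl_dist_eq1 hW cD cE)->].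
    by move=> /eqP->; split=> //; apply/(weyl_dist_eq1 hW).
  exists [::]; split=> // E; split=> // -[cE /(weyl_dist_eq1 hW cD cE) <-].
  by move=> /TD.
have redx := reduced_cons hW red.
have [l [ul lP sl]] := neighbours_card s cD.
rewrite -(weighted_count_sum x cC cD ul sl lP).
set Q := (X in enumerates X _).
have -> : Q = [set E | exists2 D1, D1 \in l &
    [/\ chamber E, weyl_dist D1 E = val x & T (weyl_dist C E)]].
  apply/seteqP; split=> E.
    move=> [cE]; rewrite val_cons => /(weyl_split hW cD cE)[D1 [cD1 Es Ex]] TE.
    by exists D1 => //; apply/lP.
  move=> [D1 /lP[cD1 Es] [cE Ex TE]]; split=> //.
  exact: weyl_dist_cons Es Ex red.
(* If D1 and D2 both led to E, they would be s-adjacent, so the distance from D1 to E would be both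
   [val x] and [gen s * val x]. *)
apply: enumerates_bigcup => // [D1 /lP[cD1 _]|D1 D2 E]; first exact: IH.
move=> /lP[cD1 H1] /lP[cD2 H2] [cE E1 _] [_ E2 _]; apply: contrapT => NE.
have H12 := neighbours_dist cD cD1 cD2 H1 H2 NE.
have := weyl_dist_cons hW cD1 cD2 cE H12 E2 red; rewrite val_cons.
rewrite E1 -{1}(mul1g (val x)) => /mulIg/esym; exact: cox_neq1.
Qed.

End Chambers.
End Count.

(** * Intersection numbers of simplices *)

Theorem theorem3p7 (W : groupType) (S : finType) (gen : S -> W)
    (hW : coxeter_system gen)
    (X : building gen) (hfin : locally_finite X)
    (q : S -> nat) (hq : regular X q)
    (I J K : {set S})
    (hI : spherical gen I) (hJ : spherical gen J) (hK : spherical gen K)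
    (u v w : W)
    (hu : double_coset_reps gen I J u)
    (hv : double_coset_reps gen K J v)
    (hw : double_coset_reps gen I K w)
    (vexpr : seq S) (hvexpr : reduced_expr gen vexpr v)
    (mexpr : W -> seq S)
    (hmexpr : forall m, left_coset_reps gen K J v m ->
       reduced_expr gen (mexpr m) m) :
  is_intersection_number X I J K u v w
    (\big[addn/0%N]_(g \in [set g : pregallery W S |
        [/\ is_pointed_pregallery gen g,
            exists2 m, left_coset_reps gen K J v m
                     & pg_type g = mexpr m ++ vexpr,
            pg_start g = w
          & double_coset gen I u J (pg_end g)]])
       pg_weight gen q g).
Proof.
set M := left_coset_reps gen K J v; set T := double_coset gen I u J.
(* M lies in W_K, which is finite as K is spherical; listing it makes the union over m a finite
   sum. *)
have finM : finite_set M by apply: sub_finite_set hK => m [].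
have [lM [ulM lMP _]] : enumerates M #|` fset_set M|.
  exists (fset_set M); split=> //; first exact: fset_uniq.
  by move=> m; rewrite in_fset_set // inE.
have valM m : M m -> word_val gen (mexpr m ++ vexpr) = (m * v)%g.
  by move=> /hmexpr[Em _]; have [Ev _] := hvexpr; rewrite val_cat Em Ev.
have redM m : M m -> cox_length gen (word_val gen (mexpr m ++ vexpr)) =
    size (mexpr m ++ vexpr).
  move=> Mm; rewrite valM // (left_coset_repsP hW hv Mm).2 size_cat.
  by have [_ ->] := hmexpr m Mm; have [_ ->] := hvexpr.
pose fibre m := [seq p <- pregalleries gen w (mexpr m ++ vexpr) | `[<T (pg_end (w, p))>]].
pose L : seq (pregallery W S) := [seq (w, p) | m <- lM, p <- fibre m].
have uL : uniq L.
  apply: allpairs_uniq_dep => // [m _|].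
    by rewrite filter_uniq // pregalleries_uniq.
  move=> _ _ /allpairsPdep[m [p [Hm Hp ->]]] /allpairsPdep[m' [p' [Hm' Hp' ->]]] /= [Ep].
  rewrite -Ep in Hp' *; suff -> : m = m' by [].
  move: Hp Hp'; rewrite !mem_filter !(pregalleriesP hW) /=.
  move=> /and3P[_ _ /eqP E1] /and3P[_ _ /eqP E2].
  (* The type of a pregallery has value mv, which determines m. *)
  have E : word_val gen (mexpr m ++ vexpr) = word_val gen (mexpr m' ++ vexpr).
    by rewrite -E1 -E2.
  by move: E; rewrite !valM; try exact/lMP; move/mulIg.
have -> : [set g : pregallery W S | [/\ is_pointed_pregallery gen g,
    exists2 m, M m & pg_type g = mexpr m ++ vexpr, pg_start g = w & T (pg_end g)]] =
    [set` L].
  apply/seteqP; split=> g /=.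
    case: g => w0 p [pp [m Mm tp] /= Ew Tg]; rewrite /pg_start /= in Ew.
    rewrite -> Ew in *.
    apply/allpairsPdep; exists m, p; split=> //; first exact/lMP.
    by rewrite mem_filter (pregalleriesP hW) pp -tp /pg_type eqxx /= andbT; apply/asboolP.
  move=> /allpairsPdep[m [p [/lMP Mm]]].
  rewrite mem_filter (pregalleriesP hW) => /and3P[/asboolP Tp pp /eqP tp] ->.
  by split=> //; exists m.
rewrite -fsbig_seq // big_allpairs_dep /=.
rewrite (eq_bigr (fun m => weighted_count gen q T w (mexpr m ++ vexpr))); last first.
  by move=> m _; rewrite big_filter; apply: sum_pregalleries.
move=> A B [sA cA] [sB cB] dAB; apply: enumerates_card.
have [C0 [C1 [hC0 hC1]]] := simplex_dist_attained hW sA sB; rewrite dAB => dC.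
have [c0 c1] := (hC0.1, hC1.1).
(* For each m, the chambers at distance mv from C1 whose distance from C0 lies in W_I u W_J. *)
have union := enumerates_bigcup (r := lM)
  (P := fun m => [set E | [/\ chamber E,
     weyl_dist C1 E = word_val gen (mexpr m ++ vexpr) & T (weyl_dist C0 E)]])
  (n := fun m => weighted_count gen q T w (mexpr m ++ vexpr)) ulM.
have {}union := union _ _.
apply: (enumerates_image (f := fun E : {fset vertex X} => face E J) _ _ _ (union _ _)).
- move=> E [m /lMP Mm [cE]]; rewrite valM // => dE TE.
  have [sD cD] := face_cotype hW J cE.
  have hE : chambers_of (face E J) E by split=> //; apply: face_sub.
  split; split=> //.
    by apply/(simplex_distE hW sA sD hC0 hE); rewrite cA cD.
  apply/(simplex_distE hW sB sD hC1 hE); rewrite cB cD // dE.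
  by apply: double_coset_mull; case: Mm.
- move=> E E' [m /lMP Mm [cE]]; rewrite valM // => dE _.
  move=> [m' /lMP Mm' [cE']]; rewrite valM // => dE' _ EF.
  have Jb := (weyl_residue hW J cE cE').2 EF.
  (* Chambers with the same face of cotype J have distances from C1 in the same left coset of W_J,
     so m = m'. *)
  have := weyl_dist_coset hW c1 cE cE' Jb; rewrite dE dE'.
  move=> /(left_coset_reps_uniq hW hv Mm Mm') mm.
  (* As mv is shortest in its coset of W_J, lengths add and the distance from C1 to E' is mv times
     that from E to E'; it is also mv, so E = E'. *)
  have [Rm _] := left_coset_repsP hW hv Mm.
  have := weyl_distM hW c1 cE cE'; rewrite dE dE' -mm.
  move=> /(_ (min_coset_len hW Rm Jb)) /esym E1.
  apply/(weyl_dist_eq1 hW cE cE'); apply: (@mulgI _ (m * v)%g).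
  by rewrite E1 mulg1.
- move=> D [[[sD cD] dA] [_ dB]].
  have [E0 hE0] := simplex_chamber hW sD; have cE0 := hE0.1.
  have := (simplex_distE hW sB sD hC1 hE0 (r := v)); rewrite cB cD.
  move=> /(_ hv) [/(_ dB) D0 _].
  have [m Mm Jm] := left_coset_reps_exists hW hv D0.
  (* E0 is an arbitrary chamber of D; E replaces it by the one at distance mv from C1. *)
  have [E [cE E1 E2]] := weyl_extend hW ((weyl_dist C1 E0)^-1 * (m * v))%g c1 cE0.
  rewrite mulVKg in E2.
  have hE : chambers_of D E.
    by apply/(chambers_of_residue hW sD hE0 cE); rewrite cD E1.
  exists E; last by rewrite -cD; apply/esym/(chambers_of_face sD hE).
  exists m; first exact/lMP.
  split=> //; first by rewrite valM.
  have := (simplex_distE hW sA sD hC0 hE (r := u)); rewrite cA cD.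
  by move=> /(_ hu) [/(_ dA)].
- by move=> m /lMP Mm; rewrite -dC; apply: count_chambers => //; apply: redM.
move=> m m' E /lMP Mm /lMP Mm' [_ E1 _] [_ E2 _].
by move: E2; rewrite E1 !valM // => /mulIg.
Qed.
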